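(* Let $\Theta$ be a nonempty set and let $\pi:\Theta\to[0,1]$ be a possibility function taking (strictly) positive values, i.e. $\pi(\theta)>0$ for all $\theta\in\Theta$ and $\sup_{\theta\in\Theta}\pi(\theta)=1$. For any function $\ell:\Theta\to\mathbb{R}$, we have $$\log \sup_{\theta \in \Theta} e^{-\ell(\theta)} \pi(\theta) = \sup_{g\in\mathcal{F}(\Theta)} \inf_{\theta \in \Theta}\left\{ -\ell(\theta) - \log\left(\frac{g(\theta)}{\pi(\theta)}\right) \right\} = \inf_{g\in\mathcal{F}(\Theta)} \sup_{\theta \in \Theta}\left\{ -\ell(\theta) - \log\left(\frac{g(\theta)}{\pi(\theta)}\right) \right\}.$$ Moreover, the supremum over $g$ in the first variational expression is achieved exactly by the possibility functions that lower-bound $g^{\star}_{\max}$: $$\operatorname*{argmax}_{g\in\mathcal{F}(\Theta)}\ \inf_{\theta\in\Theta}\left\{ -\ell(\theta) - \log\left(\frac{g(\theta)}{\pi(\theta)}\right) \right\} = \big\{ g \in \mathcal{F}(\Theta) : g \preceq g^{\star}_{\max} \big\},$$ and the infimum over $g$ in the second variational expression is achieved exactly by the possibility functions that upper-bound $g^{\star}_{\max}$: $$\operatorname*{argmin}_{g\in\mathcal{F}(\Theta)}\ \sup_{\theta\in\Theta}\left\{ -\ell(\theta) - \log\left(\frac{g(\theta)}{\pi(\theta)}\right) \right\} = \big\{ g \in \mathcal{F}(\Theta) : g^{\star}_{\max} \preceq g \big\}.$$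
   Context: A possibility function on $\Theta$ is a function $f:\Theta\to[0,1]$ with $\sup_{\theta\in\Theta} f(\theta)=1$ (the supremum need not be attained); $\mathcal{F}(\Theta)$ denotes the set of all possibility functions on $\Theta$. The partial order $\preceq$ is pointwise: $f\preceq g$ iff $f(\theta)\le g(\theta)$ for all $\theta\in\Theta$. The (generalized) possibilistic posterior is $$g^{\star}_{\max}(\theta) = \frac{e^{-\ell(\theta)}\pi(\theta)}{\sup_{\theta'\in\Theta} e^{-\ell(\theta')}\pi(\theta')},\qquad \theta\in\Theta.$$ Conventions: all quantities take values in the extended reals, with $-\log 0=+\infty$ (so the expression in braces equals $+\infty$ at points where $g(\theta)=0$) and $\log(+\infty)=+\infty$. If $\sup_{\theta'} e^{-\ell(\theta')}\pi(\theta')=+\infty$, the quotient defining $g^{\star}_{\max}$ is read with the convention $a/(+\infty)=0$. Here argmax (resp. argmin) denotes the set of $g\in\mathcal{F}(\Theta)$ at which the supremum (resp. infimum) over $\mathcal{F}(\Theta)$ is attained. *)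

(* Defs.v *)
From HB Require Import structures.
From mathcomp Require Import all_boot all_order all_algebra.
From mathcomp Require Import all_classical all_reals all_analysis.
Set Implicit Arguments.
Unset Strict Implicit.
Unset Printing Implicit Defensive.
Import Order.TTheory GRing.Theory Num.Theory.
Local Open Scope classical_set_scope.
Local Open Scope ring_scope.
Local Open Scope ereal_scope.

Section possibility.
Context {R : realType} {Theta : Type}.
Implicit Types (f g prior loss : Theta -> R) (theta : Theta).

Definition possibility_functions : set (Theta -> R) :=
  [set f | (forall theta, (0 <= f theta <= 1)%R) /\
           ereal_sup [set (f theta)%:E | theta in [set: Theta]] = 1].

Definition evidence loss prior : \bar R :=
  ereal_sup [set (expR (- loss theta) * prior theta)%:E
            | theta in [set: Theta]].

(* Extended-real division: since +oo^-1 = 0, this is identically 0 when the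
   normalizing constant is +oo, and then it is not a possibility function. *)
Definition gstar_max loss prior : Theta -> \bar R :=
  fun theta => (expR (- loss theta) * prior theta)%:E / evidence loss prior.

(* [lne] is the logarithm on [\bar R], with [lne 0 = -oo] and [lne +oo = +oo];
   in particular the value is +oo wherever [g] vanishes. *)
Definition penalized_gain loss prior g theta : \bar R :=
  - (loss theta)%:E - lne (g theta / prior theta)%:E.

Definition inf_gain loss prior g : \bar R :=
  ereal_inf [set penalized_gain loss prior g theta | theta in [set: Theta]].

Definition sup_gain loss prior g : \bar R :=
  ereal_sup [set penalized_gain loss prior g theta | theta in [set: Theta]].

End possibility.

Definition argmax {R : realType} {T : Type} (A : set T) (J : T -> \bar R) :
    set T :=
  [set a | A a /\ J a = ereal_sup [set J b | b in A]].

Definition argmin {R : realType} {T : Type} (A : set T) (J : T -> \bar R) :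
    set T :=
  [set a | A a /\ J a = ereal_inf [set J b | b in A]].

(* Pointwise order; extended-real valued because [gstar_max] is. *)
Definition pointwise_le {R : realType} {T : Type} (f g : T -> \bar R) : Prop :=
  forall x, f x <= g x.

(* Main.v *)
(* Put w = exp(-loss) * prior and Z = sup w, so that the gain of g at theta is
   ln (w theta / g theta). Comparing it with ln Z amounts to comparing g theta
   with w theta / Z, the value of gstar_max, also when Z = +oo: gstar_max is
   then 0, below every g and above no possibility function. That ln Z bounds
   inf_gain from above and sup_gain from below comes from sup g = 1 and g <= 1
   respectively. For finite Z both bounds are attained at gstar_max. *)
Require Import Defs.
From HB Require Import structures.
From mathcomp Require Import all_boot all_order all_algebra.
From mathcomp Require Import all_classical all_reals all_analysis.
Local Open Scope classical_set_scope.
Local Open Scope ring_scope.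
Local Open Scope ereal_scope.
Import Order.TTheory GRing.Theory Num.Theory.

(** * Order and logarithm on the extended reals *)

(** Reduces a comparison of possibly infinite values to real thresholds [c], the only ones for which
    [le_penalized_gain] is stated. *)
Lemma lee_EFin_lower {R : realType} (x y : \bar R) :
  (forall c : R, c%:E <= x -> c%:E <= y) -> x <= y.
Proof.
move=> xy; rewrite leNgt; apply/negP => yx.
case: y x xy yx => [y| |] [x| |] //= xy yx.
- by have := lt_le_trans yx (xy x (lexx _)); rewrite ltxx.
- by have := xy (y + 1)%R (leey _); rewrite lee_fin gerDl ler10.
- by have := xy x (lexx _).
- by have := xy 0%R (leey _).
Qed.

Lemma lne_le {R : realType} (x y : \bar R) :
  0 <= x -> (lne x <= y) = (x <= expeR y).
Proof. by move=> x0; rewrite -lee_expeR lneK// in_itv/= x0 leey. Qed.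

Lemma le_lne {R : realType} (x y : \bar R) :
  0 <= y -> (x <= lne y) = (expeR x <= y).
Proof. by move=> y0; rewrite -lee_expeR lneK// in_itv/= y0 leey. Qed.

Section gains.
Context {R : realType} {Theta : Type}.
Variables (prior loss : Theta -> R).
Hypothesis prior_gt0 : forall theta, (0 < prior theta)%R.
Hypothesis Theta_neq0 : [set: Theta] !=set0.
Implicit Types (g : Theta -> R) (theta : Theta).

Let w theta : R := (expR (- loss theta) * prior theta)%R.

Let w_gt0 theta : (0 < w theta)%R.
Proof. by rewrite mulr_gt0 ?expR_gt0. Qed.

Let w_le_evidence theta : (w theta)%:E <= evidence loss prior.
Proof. by apply: ereal_sup_ubound; exists theta. Qed.

(** * The gain at a single point *)

Lemma penalized_gain0 g theta :
  g theta = 0%R -> penalized_gain loss prior g theta = +oo.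
Proof.
by move=> g0; rewrite /penalized_gain g0 mul0r /= lexx.
Qed.

Lemma penalized_gainE g theta : (0 < g theta)%R ->
  penalized_gain loss prior g theta = (ln (w theta / g theta))%:E.
Proof.
move=> g0; rewrite /penalized_gain lne_EFin ?divr_gt0// -EFinN -EFinB.
rewrite /w !ln_div ?posrE ?mulr_gt0 ?expR_gt0// lnM ?posrE ?expR_gt0// expRK.
by rewrite opprB addrA.
Qed.

(** Clearing the denominator lets one formula cover [g theta = 0] too: the gain is then +oo, and
    both sides hold. *)
Lemma le_penalized_gain g theta (c : R) : (0 <= g theta)%R ->
  (c%:E <= penalized_gain loss prior g theta) = (expR c * g theta <= w theta)%R.
Proof.
rewrite le_eqVlt => /predU1P[/esym g0|g0].
  by rewrite penalized_gain0// leey g0 mulr0 ltW.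
by rewrite penalized_gainE// lee_fin -ler_pdivlMr// -ler_expR lnK
  ?posrE ?divr_gt0.
Qed.

(** Where [g] vanishes, both sides fail, the right one because w > 0. *)
Lemma penalized_gain_le g theta (c : R) : (0 <= g theta)%R ->
  (penalized_gain loss prior g theta <= c%:E) = (w theta <= expR c * g theta)%R.
Proof.
rewrite le_eqVlt => /predU1P[/esym g0|g0].
  by rewrite penalized_gain0// g0 mulr0 leNgt ltry lt_geF.
by rewrite penalized_gainE// lee_fin -ler_pdivrMr// -ler_expR lnK
  ?posrE ?divr_gt0.
Qed.

(** * Comparison of the gain with ln Z *)

Lemma evidence_gt0 : 0 < evidence loss prior.
Proof.
have [theta _] := Theta_neq0.
by apply: lt_le_trans (w_le_evidence theta); rewrite lte_fin.
Qed.

(** Positivity excludes Z = 0; writing a finite Z as [expR c] makes its logarithm the real number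
    [c]. *)
Lemma evidence_cases : evidence loss prior = +oo \/
  exists c : R, evidence loss prior = (expR c)%:E.
Proof.
have := evidence_gt0; have [y <-] := expeR_total (ltW evidence_gt0).
by case: y => [c| |]; [right; exists c|left|rewrite ltxx].
Qed.

Lemma gstar_maxy theta :
  evidence loss prior = +oo -> gstar_max loss prior theta = 0.
Proof. by rewrite /gstar_max => ->; rewrite invey mule0. Qed.

Lemma gstar_max_fin theta (c : R) : evidence loss prior = (expR c)%:E ->
  gstar_max loss prior theta = (w theta / expR c)%:E.
Proof. by rewrite /gstar_max => ->; rewrite inver gt_eqF ?expR_gt0. Qed.

Lemma lne_evidence_le_penalized_gain g theta : (0 <= g theta)%R ->
  (lne (evidence loss prior) <= penalized_gain loss prior g theta) =
  ((g theta)%:E <= gstar_max loss prior theta).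
Proof.
move=> g0; have [Zy|[c Zc]] := evidence_cases.
  (* For Z = +oo, the gain reaches ln Z = +oo only where [g] vanishes, which is exactly where [g]
     lies below [gstar_max] = 0. *)
  rewrite gstar_maxy// Zy /= lee_fin.
  move: g0; rewrite le_eqVlt => /predU1P[/esym g0|g0].
    by rewrite penalized_gain0// g0 !lexx.
  by rewrite penalized_gainE// leNgt ltry leNgt g0.
rewrite (gstar_max_fin _ _ Zc) Zc lne_EFin ?expR_gt0// expRK.
by rewrite le_penalized_gain// lee_fin ler_pdivlMr ?expR_gt0// mulrC.
Qed.

Lemma penalized_gain_le_lne_evidence g theta : (0 <= g theta)%R ->
  (penalized_gain loss prior g theta <= lne (evidence loss prior)) =
  (gstar_max loss prior theta <= (g theta)%:E).
Proof.
move=> g0; have [Zy|[c Zc]] := evidence_cases.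
  by rewrite gstar_maxy// Zy /= leey lee_fin g0.
rewrite (gstar_max_fin _ _ Zc) Zc lne_EFin ?expR_gt0// expRK.
by rewrite penalized_gain_le// lee_fin ler_pdivrMr ?expR_gt0// mulrC.
Qed.

(** * Global bounds by ln Z and their equality cases *)

Lemma possibility_ge0 g theta : possibility_functions g -> (0 <= g theta)%R.
Proof. by case=> /(_ theta)/andP[]. Qed.

(** If a real [c] bounds all gains from below, then [expR c] * g <= w <= Z pointwise; the supremum
    over theta, with sup g = 1, gives [expR c] <= Z. *)
Lemma inf_gain_le g : possibility_functions g ->
  inf_gain loss prior g <= lne (evidence loss prior).
Proof.
move=> Fg; apply: lee_EFin_lower => c /ereal_infP cg.
rewrite le_lne ?(ltW evidence_gt0)//= -[leLHS]mul1e -lee_pdivlMr ?expR_gt0//.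
rewrite -(proj2 Fg); apply/ereal_supP => _ [theta _ <-].
rewrite lee_pdivlMr ?expR_gt0//; apply: le_trans (w_le_evidence theta).
rewrite -EFinM lee_fin mulrC -le_penalized_gain ?possibility_ge0//.
by apply: cg; exists theta.
Qed.

(** Since g <= 1, the gain at each theta is at least ln (w theta); the supremum of these values is
    ln Z. *)
Lemma sup_gain_ge g : possibility_functions g ->
  lne (evidence loss prior) <= sup_gain loss prior g.
Proof.
move=> Fg; rewrite lne_le ?(ltW evidence_gt0)//.
apply/ereal_supP => _ [theta _ <-]; rewrite -/(w theta).
rewrite -lne_le ?lee_fin ?(ltW (w_gt0 _))// lne_EFin//.
apply: (@le_trans _ _ (penalized_gain loss prior g theta)).
  rewrite le_penalized_gain ?possibility_ge0// lnK ?posrE//.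
  by rewrite ler_piMr ?(ltW (w_gt0 _))//; have [/(_ theta)/andP[]] := Fg.
by apply: ereal_sup_ubound; exists theta.
Qed.

(** One inequality always holds, so equality means that every gain is at least ln Z, a condition
    that can be tested pointwise. *)
Lemma inf_gain_eq g : possibility_functions g ->
  inf_gain loss prior g = lne (evidence loss prior) <->
  pointwise_le (EFin \o g) (gstar_max loss prior).
Proof.
move=> Fg; split=> [gZ theta|gZ].
  rewrite -lne_evidence_le_penalized_gain ?possibility_ge0// -gZ.
  by apply: ereal_inf_lbound; exists theta.
apply/eqP; rewrite eq_le inf_gain_le//=; apply/ereal_infP => _ [theta _ <-].
by rewrite lne_evidence_le_penalized_gain ?possibility_ge0//; apply: gZ.
Qed.

Lemma sup_gain_eq g : possibility_functions g ->
  sup_gain loss prior g = lne (evidence loss prior) <->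
  pointwise_le (gstar_max loss prior) (EFin \o g).
Proof.
move=> Fg; split=> [gZ theta|gZ].
  rewrite -penalized_gain_le_lne_evidence ?possibility_ge0// -gZ.
  by apply: ereal_sup_ubound; exists theta.
apply/eqP; rewrite eq_le sup_gain_ge// andbT; apply/ereal_supP => _ [theta _ <-].
by rewrite penalized_gain_le_lne_evidence ?possibility_ge0//; apply: gZ.
Qed.

(** * Optimal and nearly optimal possibility functions *)

Lemma gstar_max_possibility (c : R) : evidence loss prior = (expR c)%:E ->
  exists2 g, possibility_functions g & EFin \o g = gstar_max loss prior.
Proof.
move=> Zc; exists (fun theta => w theta / expR c)%R; last first.
  by apply/funext => theta; rewrite (gstar_max_fin _ _ Zc).
have g1 theta : (w theta / expR c <= 1)%R.
  by rewrite ler_pdivrMr ?expR_gt0// mul1r -lee_fin -Zc.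
split=> [theta|]; first by rewrite g1 divr_ge0 ?(ltW (w_gt0 _)) ?expR_ge0.
apply/eqP; rewrite eq_le; apply/andP; split.
  by apply/ereal_supP => _ [theta _ <-]; rewrite lee_fin.
(* Scaling by Z = [expR c] turns 1 <= sup (w / Z) into Z <= sup (w / Z) * Z, which is checked on
   each value of w. *)
rewrite -(@lee_pmul2r _ (expR c)%:E) ?lte_fin ?expR_gt0// mul1e -{1}Zc.
apply/ereal_supP => _ [theta _ <-]; rewrite -lee_pdivrMr ?expR_gt0//.
by apply: ereal_sup_ubound; exists theta.
Qed.

(* Witness: the indicator function of [expR c <= w]. *)
Lemma inf_gain_unbounded (c : R) : evidence loss prior = +oo ->
  exists2 g, possibility_functions g & c%:E <= inf_gain loss prior g.
Proof.
move=> Zy.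
(* A point where the indicator takes the value 1, so that its supremum is 1; it exists because w is
   unbounded. *)
have [theta0 w0] : exists theta, (expR c <= w theta)%R.
  apply: contrapT => /forallNP cw.
  suff: evidence loss prior <= (expR c)%:E by rewrite Zy leNgt ltry.
  apply/ereal_supP => _ [theta _ <-]; rewrite lee_fin leNgt.
  by apply/negP => /ltW; apply: cw.
pose g theta : R := ((expR c <= w theta)%R)%:R.
exists g; last first.
  apply/ereal_infP => _ [theta _ <-]; rewrite le_penalized_gain ?ler0n//.
  rewrite /g; case: (expR c <= w theta)%R /boolP => [|_]; rewrite ?mulr1//.
  by rewrite mulr0 ltW.
have g01 theta : (0 <= g theta <= 1)%R by rewrite ler0n lern1 leq_b1.
split=> //; apply/eqP; rewrite eq_le; apply/andP; split.
  by apply/ereal_supP => _ [theta _ <-]; rewrite lee_fin; case/andP: (g01 theta).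
by apply: ereal_sup_ubound; exists theta0; rewrite // /g w0.
Qed.

(** * The two optimal values *)

Lemma sup_inf_gain :
  ereal_sup [set inf_gain loss prior g | g in possibility_functions] =
  lne (evidence loss prior).
Proof.
apply/eqP; rewrite eq_le; apply/andP; split.
  by apply/ereal_supP => _ [g Fg <-]; apply: inf_gain_le.
have [Zy|[c /gstar_max_possibility[g Fg gE]]] := evidence_cases.
  (* For Z = +oo no possibility function attains the supremum, so +oo is approached through
     arbitrarily large real [c]. *)
  apply: lee_EFin_lower => c _.
  have [g Fg cg] := inf_gain_unbounded c Zy; apply: le_trans cg _.
  by apply: ereal_sup_ubound; exists g.
apply: ereal_sup_ubound; exists g => //; apply/(inf_gain_eq _ Fg).
by move=> theta; rewrite gE.
Qed.

Lemma inf_sup_gain : possibility_functions prior ->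
  ereal_inf [set sup_gain loss prior g | g in possibility_functions] =
  lne (evidence loss prior).
Proof.
move=> Fprior; apply/eqP; rewrite eq_le; apply/andP; split; last first.
  by apply/ereal_infP => _ [g Fg <-]; apply: sup_gain_ge.
have [Zy|[c /gstar_max_possibility[g Fg gE]]] := evidence_cases.
  by rewrite Zy leey.
apply: ereal_inf_lbound; exists g => //; apply/(sup_gain_eq _ Fg).
by move=> theta; rewrite gE.
Qed.

End gains.

Theorem theorem2 (R : realType) (Theta : Type) (Theta_neq0 : [set: Theta] !=set0)
    (prior : Theta -> R) (prior_possibility : possibility_functions prior)
    (prior_gt0 : forall theta, (0 < prior theta)%R)
    (loss : Theta -> R) :
  [/\ lne (ereal_sup [set (expR (- loss theta) * prior theta)%:E
                     | theta in [set: Theta]])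
      = ereal_sup [set inf_gain loss prior g | g in possibility_functions],
      ereal_sup [set inf_gain loss prior g | g in possibility_functions]
      = ereal_inf [set sup_gain loss prior g | g in possibility_functions],
      argmax possibility_functions (inf_gain loss prior)
      = [set g | possibility_functions g /\
                 pointwise_le (EFin \o g) (gstar_max loss prior)]
    & argmin possibility_functions (sup_gain loss prior)
      = [set g | possibility_functions g /\
                 pointwise_le (gstar_max loss prior) (EFin \o g)] ].
Proof.
have sup_inf := sup_inf_gain prior loss prior_gt0 Theta_neq0.
have inf_sup := inf_sup_gain prior loss prior_gt0 Theta_neq0 prior_possibility.
split.
- exact/esym.
- by rewrite sup_inf inf_sup.
(* With the optimal value known to be ln Z, attaining it is the equality that [inf_gain_eq]
   characterizes; [sup_gain_eq] serves the argmin likewise. *)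
- apply/seteqP; split=> g [Fg gE]; split=> //.
    by apply/(inf_gain_eq prior loss prior_gt0 Theta_neq0 g Fg); rewrite gE.
  by rewrite sup_inf; apply/(inf_gain_eq prior loss prior_gt0 Theta_neq0 g Fg).
- apply/seteqP; split=> g [Fg gE]; split=> //.
    by apply/(sup_gain_eq prior loss prior_gt0 Theta_neq0 g Fg); rewrite gE.
  by rewrite inf_sup; apply/(sup_gain_eq prior loss prior_gt0 Theta_neq0 g Fg).
Qed.
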